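(* Let $\nu\in\mathcal M^1$ be a probability measure and let $(X,Y)$ be a $\nu$-decomposable pair, with null $\sigma$-ideal $\Xi=\{A\in\mathcal F : \forall\mu\in X,\ |\mu|(A)=0\}$. Let $\varphi_+:\mathbb R\to\mathbb R\cup\{+\infty\}$ be defined by $\varphi_+(x)=\varphi(x)$ if $x\ge 0$ and $\varphi_+(x)=+\infty$ if $x<0$, and let $\varphi_+^\star$ be its convex conjugate. Then the function $\widetilde D_{\varphi,\nu}:X\to\mathbb R\cup\{+\infty\}$, equal to $D_\varphi(\mu\|\nu)$ if $\mu\in X\cap\mathcal M^1$ and to $+\infty$ otherwise, is lower semicontinuous on $X$ (for any locally convex topology on $X$ compatible with the pairing of $X$ and $Y$). In particular, for every probability measure $\mu\in X\cap\mathcal M^1$, $$D_\varphi(\mu\|\nu)=\sup_{g\in Y}\Big\{\int g\,d\mu-\inf\Big\{\int\varphi_+^\star(g+\lambda)\,d\nu-\lambda \;:\; \lambda\in\mathbb R,\ \lambda+\operatorname{ess\,sup}_\Xi g\le\varphi'(\infty)\Big\}\Big\}.$$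
   Context: $(\Omega,\mathcal F)$ is a measurable space with $\{\emptyset,\Omega\}\subsetneq\mathcal F$; $\mathcal M,\mathcal M^+,\mathcal M^1$ are the sets of finite signed measures, finite non-negative measures and probability measures on it. $\mathcal M_c(\nu)=\{\mu\in\mathcal M:\mu\ll\nu\}$. For a $\sigma$-ideal $\Xi\subseteq\mathcal F$, $L^0(\Xi)$ is the space of real measurable functions modulo equality outside an element of $\Xi$. The $\Xi$-essential range of $f$ is $\operatorname{ess\,im}_\Xi f=\bigcap_{\epsilon>0}\{x\in\mathbb R: f^{-1}((x-\epsilon,x+\epsilon))\notin\Xi\}$, $\operatorname{ess\,sup}_\Xi f=\sup\operatorname{ess\,im}_\Xi f$, and $L^\infty(\Xi)$ is the space of functions with bounded $\Xi$-essential range. $\varphi:\mathbb R\to\mathbb R\cup\{+\infty\}$ is a fixed convex lower semicontinuous function with $\varphi(1)=0$ and such that $\operatorname{dom}\varphi=\{\varphi<+\infty\}$ contains a neighborhood of $1$. $\varphi'(\pm\infty)=\lim_{x\to\pm\infty}\varphi(x)/x$ (in the extended reals). The convex conjugate of $f:\mathbb R\to\overline{\mathbb R}$ is $f^\star(y)=\sup_x\{xy-f(x)\}$. For $\mu\in\mathcal M$, $\nu\in\mathcal M^+$ with Lebesgue decomposition $\mu=\mu_c+\mu_s$ ($\mu_c\ll\nu$, $\mu_s\perp\nu$) and Hahn–Jordan decomposition $\mu_s=\mu_s^+-\mu_s^-$, $$D_\varphi(\mu\|\nu)=\int\varphi\Big(\frac{d\mu_c}{d\nu}\Big)d\nu+\mu_s^+(\Omega)\varphi'(\infty)-\mu_s^-(\Omega)\varphi'(-\infty),\qquad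 0\cdot(\pm\infty)=0.$$ Decomposability: let $X\subseteq\mathcal M$ be a vector space of finite signed measures with null $\sigma$-ideal $\Xi=\{A\in\mathcal F:\forall\mu\in X,|\mu|(A)=0\}$, $Y$ a vector space of measurable functions, $\nu\in X\cap\mathcal M^+$. The pair $(X,Y)$ is $\nu$-decomposable if (1) the pairing $(\mu,h)\mapsto\int h\,d\mu$ is well defined and puts $X$ and $Y$ in separating duality; (2) $\{\mu\in\mathcal M_c(\nu): d\mu/d\nu\in L^\infty(\nu)\}\subseteq X$ and $L^\infty(\Xi)\subseteq Y\subseteq L^0(\Xi)$; (3) for every $A\in\mathcal F\setminus\Xi$ there is a nonzero $\mu\in X\cap\mathcal M^+$ with $\mu(\Omega\setminus A)=0$. A locally convex topology on $X$ is compatible with the pairing if the topological dual of $X$ is $Y$ (e.g. the weak topology $\sigma(X,Y)$). *)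

(* Defs.v *)
From HB Require Import structures.
From mathcomp Require Import all_boot all_order all_algebra.
From mathcomp Require Import all_classical all_reals all_analysis.
Set Implicit Arguments.
Unset Strict Implicit.
Unset Printing Implicit Defensive.
Import Order.TTheory GRing.Theory Num.Theory.
Import numFieldNormedType.Exports.
Local Open Scope classical_set_scope.
Local Open Scope ring_scope.
Local Open Scope ereal_scope.
Local Open Scope charge_scope.

(* Finite signed measures are charges.  The value of a charge on a
   non-measurable set is arbitrary, so equality of signed measures is
   equality on measurable sets ([eq_charge]), not Leibniz equality. *)
Section signed_measures.
Context d (T : measurableType d) (R : realType).
Implicit Types (mu : {charge set T -> \bar R}) (A : set T).

Definition eq_charge mu1 mu2 := forall A, measurable A -> mu1 A = mu2 A.

Definition hahn_pos mu : set T := sval (cid (Hahn_decomposition mu)).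

Definition hahn_neg mu : set T :=
  sval (cid (svalP (cid (Hahn_decomposition mu)))).

Lemma hahnP mu : hahn_decomposition mu (hahn_pos mu) (hahn_neg mu).
Proof. exact: (svalP (cid (svalP (cid (Hahn_decomposition mu))))). Qed.

Definition pos_part mu : {finite_measure set T -> \bar R} :=
  jordan_pos (hahnP mu).

Definition neg_part mu : {finite_measure set T -> \bar R} :=
  jordan_neg (hahnP mu).

Definition total_variation mu : {measure set T -> \bar R} :=
  charge_variation (hahnP mu).

Definition nonneg_charge mu := forall A, measurable A -> 0 <= mu A.

Definition prob_charge mu := nonneg_charge mu /\ mu [set: T] = 1.

Definition mutually_singular mu (nu : {measure set T -> \bar R}) :=
  exists A, [/\ measurable A, nu A = 0 & total_variation mu (~` A) = 0].

Lemma lebesgue_decomposition mu (nu : {finite_measure set T -> \bar R}) :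
  exists mu_c mu_s : {charge set T -> \bar R},
    [/\ mu_c `<< nu, mutually_singular mu_s nu
      & eq_charge mu (cadd mu_c mu_s)].
Proof.
pose tv := total_variation mu.
pose S := [set tv A | A in [set A | measurable A /\ nu A = 0]].
have tvfin A : measurable A -> tv A \is a fin_num.
  by move=> mA; rewrite fin_numD /= !fin_num_measure.
have Ssub x : S x -> x <= tv setT.
  by move=> [A [mA _] <-]; rewrite le_measure// inE.
have Sge0 : 0 <= ereal_sup S.
  by apply: ereal_sup_ubound; exists set0; rewrite ?measure0; split.
have Sfin : ereal_sup S \is a fin_num.
  rewrite ge0_fin_numE// (le_lt_trans (ge_ereal_sup Ssub))//.
  by rewrite -ge0_fin_numE// tvfin.
have /choice[F FP] : forall n, exists A,
    [/\ measurable A, nu A = 0 & ereal_sup S - n.+1%:R^-1%:E < tv A].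
  move=> n; have n0 : (0 < n.+1%:R^-1 :> R)%R by [].
  have [x [A [mA nA] <-] lt] := ub_ereal_sup_adherent n0 Sfin.
  by exists A.
pose U := \bigcup_n F n.
have mF n : measurable (F n) by case: (FP n).
have mU : measurable U by exact: bigcupT_measurable.
have nU : nu U = 0.
  apply/negligibleP => //; apply: negligible_bigcup => n.
  by apply/negligibleP => //; case: (FP n).
have tvU : ereal_sup S <= tv U.
  apply/lee_addgt0Pr => e e0.
  have [n ne] : exists n, (n.+1%:R^-1 < e)%R.
    by have [n] := ltr_add_invr e0; rewrite add0r; exists n.
  have [_ _ lt] := FP n.
  rewrite -leeBlDr//; apply: le_trans (_ : tv (F n) <= _); last first.
    by rewrite le_measure ?inE//; exact: bigcup_sup.
  by apply: le_trans (ltW lt); rewrite leeB// lee_fin ltW.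
have mUC : measurable (~` U) by exact: measurableC.
exists (crestr0 mu mUC), (crestr0 mu mU); split.
- apply/null_content_dominatesP => A mA nA.
  rewrite /= /crestr0 mem_set// /crestr.
  have mAU : measurable (A `&` ~` U) by exact: measurableI.
  have nAU : nu (A `&` ~` U) = 0.
    by apply/eqP; rewrite -measure_le0 -nA le_measure ?inE//; exact: subIsetl.
  have le : tv (U `|` (A `&` ~` U)) <= ereal_sup S.
    apply: ereal_sup_ubound; exists (U `|` (A `&` ~` U)) => //.
    split; first exact: measurableU.
    by rewrite measureU0.
  rewrite measureU// in le; last by rewrite setICA setICr setI0.
  have tv0 : tv (A `&` ~` U) = 0.
    apply/eqP; rewrite -measure_le0 -(@leeD2lE _ (tv U)) ?tvfin// adde0.
    exact: le_trans le tvU.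
  apply/eqP; rewrite -abse_eq0 eq_le abse_ge0 andbT -tv0.
  exact: (abse_charge_variation (hahnP mu) mAU).
- exists U; split => //.
  have h B (mB : measurable B) : crestr0 (crestr0 mu mU) mB (~` U) = 0.
    rewrite /crestr0; case: ifP => // _.
    rewrite {1}/crestr; case: ifP => // _.
    by rewrite /crestr setIAC setICl set0I charge0.
  rewrite /= /charge_variation /jordan_pos /jordan_neg /measure_of_charge /=.
  rewrite h add0e /cscale.
  by transitivity ((-1)%:E * 0 : \bar R); [congr (_ * _); exact: h|rewrite mule0].
- move=> A mA.
  transitivity (mu (A `&` ~` U) + mu (A `&` U)).
    have disj : (A `&` ~` U) `&` (A `&` U) = set0.
      by rewrite setIACA setICl setI0.
    have mA1 : measurable (A `&` ~` U) by exact: measurableI.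
    have mA2 : measurable (A `&` U) by exact: measurableI.
    by rewrite -(chargeU mu mA1 mA2 disj) -setIUr setUC setUv setIT.
  have r B (mB : measurable B) : crestr0 mu mB A = mu (A `&` B).
    by rewrite /crestr0 mem_set.
  by congr (_ + _); apply/esym; exact: r.
Qed.

Definition ac_part mu (nu : {finite_measure set T -> \bar R}) :
    {charge set T -> \bar R} :=
  sval (cid (lebesgue_decomposition mu nu)).

Definition sing_part mu (nu : {finite_measure set T -> \bar R}) :
    {charge set T -> \bar R} :=
  sval (cid (svalP (cid (lebesgue_decomposition mu nu)))).

Lemma lebesgue_decompositionP mu (nu : {finite_measure set T -> \bar R}) :
  [/\ ac_part mu nu `<< nu, mutually_singular (sing_part mu nu) nu
    & eq_charge mu (cadd (ac_part mu nu) (sing_part mu nu))].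
Proof. exact: (svalP (cid (svalP (cid (lebesgue_decomposition mu nu))))). Qed.

Definition pairing mu (h : T -> R) : R :=
  (\int[pos_part mu]_x h x - \int[neg_part mu]_x h x)%R.

End signed_measures.

Section phi_divergence.
Context (R : realType).
Implicit Types phi f : R -> \bar R.

Definition convex_ereal phi := forall (x y t : R), (0 <= t <= 1)%R ->
  phi (t * x + (1 - t) * y)%R <= t%:E * phi x + (1 - t)%:E * phi y.

Definition slope_pinfty phi : \bar R :=
  lim (phi x * (x^-1)%:E @[x --> +oo%R]).

Definition slope_ninfty phi : \bar R :=
  lim (phi x * (x^-1)%:E @[x --> -oo%R]).

Definition convex_conjugate f (y : R) : \bar R :=
  ereal_sup [set (x * y)%:E - f x | x in [set: R]].

Definition phi_plus phi (x : R) : \bar R :=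
  if (0 <= x)%R then phi x else +oo.

Context d (T : measurableType d).

(* [ac_part mu nu `<< nu], so its Radon-Nikodym derivative is finite
   everywhere and [fine] loses nothing. *)
Definition phi_div phi (mu : {charge set T -> \bar R})
    (nu : {finite_measure set T -> \bar R}) : \bar R :=
  \int[nu]_x phi (fine (('d (ac_part mu nu) '/d nu) x))
  + pos_part (sing_part mu nu) [set: T] * slope_pinfty phi
  - neg_part (sing_part mu nu) [set: T] * slope_ninfty phi.

Definition phi_div_prob phi (nu : {finite_measure set T -> \bar R})
    (mu : {charge set T -> \bar R}) : \bar R :=
  if `[< prob_charge mu >] then phi_div phi mu nu else +oo.

End phi_divergence.

(* Elements of L^0(Xi) and L^oo(Xi) are represented by functions, compared
   with [eq_mod Xi]. *)
Section function_spaces.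
Context d (T : measurableType d) (R : realType).
Implicit Types (Xi : set (set T)) (f g : T -> R).

Definition eq_mod Xi f g :=
  exists2 A, Xi A & forall x, ~ A x -> f x = g x.

Definition ess_im Xi f : set R :=
  [set x | forall e : R, (0 < e)%R ->
     ~ Xi (f @^-1` `](x - e)%R, (x + e)%R[%classic)].

Definition ess_sup_mod Xi f : \bar R := ereal_sup (EFin @` ess_im Xi f).

Definition L0 Xi : set (T -> R) := [set f | measurable_fun setT f].

Definition Linfty Xi : set (T -> R) :=
  [set f | measurable_fun setT f /\ bounded_set (ess_im Xi f)].

Definition null_ideal (nu : {measure set T -> \bar R}) : set (set T) :=
  [set A | measurable A /\ nu A = 0].

Definition common_null_ideal (X : set ({charge set T -> \bar R})) :
    set (set T) :=
  [set A | measurable A /\ forall mu, X mu -> total_variation mu A = 0].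

End function_spaces.
Arguments L0 {d T R} Xi.

Section decomposable.
Context d (T : measurableType d) (R : realType).

Record charge_space (X : set ({charge set T -> \bar R})) : Prop := {
  charge_space_eq : forall mu1 mu2, eq_charge mu1 mu2 -> X mu1 -> X mu2 ;
  charge_space0 : X czero ;
  charge_spaceP : forall (a : R) mu1 mu2, X mu1 -> X mu2 ->
    X (cadd (cscale a mu1) mu2) }.

Record function_space (Xi : set (set T)) (Y : set (T -> R)) : Prop := {
  function_space_eq : forall g h, measurable_fun setT h ->
    eq_mod Xi g h -> Y g -> Y h ;
  function_space0 : Y (fun=> 0%R) ;
  function_spaceP : forall (a : R) g h, Y g -> Y h ->
    Y (fun x => a * g x + h x)%R }.

Record separating_duality (X : set ({charge set T -> \bar R}))
    (Y : set (T -> R)) : Prop := {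
  duality_integrable : forall mu h, X mu -> Y h ->
    (total_variation mu).-integrable setT (EFin \o h) ;
  duality_sepr : forall h, Y h -> (forall mu, X mu -> pairing mu h = 0%R) ->
    eq_mod (common_null_ideal X) h (fun=> 0%R) ;
  duality_sepl : forall mu, X mu -> (forall h, Y h -> pairing mu h = 0%R) ->
    eq_charge mu czero }.

Record decomposable (nu : {finite_measure set T -> \bar R})
    (X : set ({charge set T -> \bar R})) (Y : set (T -> R)) : Prop := {
  decomposable_charge_space : charge_space X ;
  decomposable_function_space : function_space (common_null_ideal X) Y ;
  decomposable_nu : X (charge_of_finite_measure nu) ;
  decomposable_duality : separating_duality X Y ;
  decomposable_bounded_density : forall mu : {charge set T -> \bar R}, mu `<< nu ->
    Linfty (null_ideal nu) (fine \o 'd mu '/d nu) -> X mu ;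
  decomposable_Linfty : Linfty (common_null_ideal X) `<=` Y ;
  decomposable_L0 : Y `<=` L0 (common_null_ideal X) ;
  decomposable_support : forall A, measurable A -> ~ common_null_ideal X A ->
    exists mu, [/\ X mu, nonneg_charge mu, ~ eq_charge mu czero
                 & mu (~` A) = 0] }.

(* A locally convex topology on X is given by a locally convex space E
   together with a linear bijection J from E onto X. *)
Record realizes (X : set ({charge set T -> \bar R})) (E : tvsType R)
    (J : E -> {charge set T -> \bar R}) : Prop := {
  realizes_in : forall u, X (J u) ;
  realizes_surj : forall mu, X mu -> exists u, eq_charge (J u) mu ;
  realizes_inj : forall u v, eq_charge (J u) (J v) -> u = v ;
  realizes_linear : forall (a : R) u v,
    eq_charge (J (a *: u + v)%R) (cadd (cscale a (J u)) (J v)) }.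

Definition compatible (Y : set (T -> R)) (E : tvsType R)
    (J : E -> {charge set T -> \bar R}) :=
  forall l : {linear E -> R^o}, continuous l <->
    exists2 h, Y h & forall u, l u = pairing (J u) h.

End decomposable.

(* Main.v *)
Require Import Defs.
From HB Require Import structures.
From mathcomp Require Import all_boot all_order all_algebra.
From mathcomp Require Import all_classical all_reals all_analysis.
From mathcomp Require Import measurable_realfun ring lra.
Set Implicit Arguments.
Unset Strict Implicit.
Unset Printing Implicit Defensive.
Import Order.TTheory GRing.Theory Num.Theory.
Import numFieldNormedType.Exports.
Local Open Scope classical_set_scope.
Local Open Scope ring_scope.
Local Open Scope ereal_scope.

(* Write [D] for the divergence, [P] for a probability in [X] with density [r]
   and singular set [S], and [psi] for the conjugate of [phi_plus].  Young's
   inequality off [S] and the bound [g + l <= slope] on [S] give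
   [\int g dP + l <= D + \int psi (g + l) dnu].  Conversely, [phi] is on [0, oo) a
   countable supremum of affine functions [t y_i - c_i], each with
   [y_i <= slope].  Picking at every point the best of the first [n] of them gives
   a bounded function taking finitely many values, and by monotone convergence
   [\int (r y - c) dnu] approaches [\int phi(r) dnu].  Setting [g] to this
   function off [S] and to a constant close to [slope] on [S] reaches any value
   below [D].  So [D] is, on probabilities, a supremum of continuous affine
   functionals given by bounded test functions; indicator functions show that the
   set of probabilities is closed. *)

(** * Convex functions on the line: affine minorants and the slope at infinity *)

Section convex_real.
Context (R : realType) (phi : R -> \bar R).
Hypothesis phi_ninfty : forall x, phi x != -oo.
Hypothesis phi_convex : convex_ereal phi.

(** Clearing the denominator [y - x] leaves an inequality fit for linear arithmetic, and the lower
    bound [c] in place of [phi z] spares a case on whether [phi z] is finite. *)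
Lemma convex_three_points (x z y a b c : R) : (x < z < y)%R ->
  phi x = a%:E -> phi y = b%:E -> c%:E <= phi z ->
  ((y - x) * c <= (y - z) * a + (z - x) * b)%R.
Proof.
move=> /andP[xz zy] pxa pyb cz.
have yx : (0 < y - x)%R by lra.
have t01 : (0 <= (y - z) / (y - x) <= 1)%R.
  by rewrite divr_ge0 ?ler_pdivrMr ?mul1r; lra.
have := phi_convex x y t01.
have -> : ((y - z) / (y - x) * x + (1 - (y - z) / (y - x)) * y = z)%R.
  by field; lra.
move=> /(le_trans cz); rewrite pxa pyb -!EFinM -EFinD lee_fin => h.
rewrite -ler_pdivlMl//; apply: le_trans h _.
by rewrite le_eqVlt; apply/orP; left; apply/eqP; field; lra.
Qed.

Lemma ereal_fin_or_pinfty x : (exists a, phi x = a%:E) \/ phi x = +oo.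
Proof.
by have := phi_ninfty x; case: (phi x) => [a| |] // _; [left; exists a|right].
Qed.

Hypothesis phi1 : phi 1%R = 0.
Hypothesis phi_dom : \forall x \near (1%R : R), phi x < +oo.

(** For [x] on one side of 1, take a point of the domain on the other side: the chord between them
    lies above [phi 1 = 0] at 1, which bounds [phi x] below linearly. Adding both absolute values in
    [M] gives one constant for the two sides. *)
Lemma convex_ge_abs : exists2 M : R, (0 <= M)%R &
  forall x, (- (M * `|x - 1|))%:E <= phi x.
Proof.
have [e /= e0 eb] := phi_dom.
have fin x : ball (1:R)%R e x -> exists a, phi x = a%:E.
  by move=> /eb; case: (ereal_fin_or_pinfty x) => // ->.
have [u pu] : exists a, phi (1 + e / 2)%R = a%:E.
  by apply: fin; rewrite /ball /= opprD addNKr normrN gtr0_norm; lra.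
have [v pv] : exists a, phi (1 - e / 2)%R = a%:E.
  by apply: fin; rewrite /ball /= opprB addrC subrK gtr0_norm; lra.
exists ((`|u| + `|v|) / (e / 2))%R => [|x].
  by rewrite divr_ge0 ?addr_ge0//; lra.
have [[a xa]|->] := ereal_fin_or_pinfty x; last by rewrite leey.
rewrite xa lee_fin mulrAC lerNl ler_pdivlMr; last lra.
have uu := ler_norm u; have vv := ler_norm v.
have v0 := normr_ge0 v; have u0 := normr_ge0 u.
have [x1|x1|x1] := ltgtP x 1%R.
- have h : (x < 1 < 1 + e / 2)%R by lra.
  have := convex_three_points h xa pu (c := 0%R); rewrite phi1 => /(_ (lexx _)).
  have : (0 <= (1 - x) * (`|u| + `|v| - u))%R by apply: mulr_ge0; lra.
  by rewrite (@ltr0_norm _ (x - 1)%R); lra.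
- have h : (1 - e / 2 < 1 < x)%R by lra.
  have := convex_three_points h pv xa (c := 0%R); rewrite phi1 => /(_ (lexx _)).
  have : (0 <= (x - 1) * (`|u| + `|v| - v))%R by apply: mulr_ge0; lra.
  by rewrite (@gtr0_norm _ (x - 1)%R); lra.
- by move: xa; rewrite x1 phi1 => -[<-]; rewrite subrr normr0; lra.
Qed.

Hypothesis phi_lsc : lower_semicontinuous phi.

(* The slope is squeezed between the slopes of the chords from [(r, a)] to the
   graph on either side; lower semicontinuity keeps those chords away from
   being vertical. *)
Lemma affine_minorant_gt (r a : R) : a%:E < phi r ->
  exists y c : R, (forall x, (x * y - c)%:E <= phi x) /\ (a < r * y - c)%R.
Proof.
move=> ar; have [a' /andP[aa' a'r]] : exists a', (a < a')%R && (a'%:E < phi r).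
  have [[p rp]|->] := ereal_fin_or_pinfty r.
    by exists ((a + p) / 2)%R; move: ar; rewrite rp !lte_fin => ?; apply/andP; split; lra.
  by exists (a + 1)%R; rewrite ltry andbT; lra.
suff [y hy] : exists y, forall x, (x * y - (r * y - a'))%:E <= phi x.
  by exists y, (r * y - a')%R; split => //; lra.
have [M M0 hM] := convex_ge_abs.
have [V [e /= e0 eV] hV] := phi_lsc a'r.
have near_r x : (`|x - r| < e)%R -> a'%:E < phi x.
  by move=> xr; apply: hV; apply: eV; rewrite /ball/= distrC.
pose B : R := ((`|a'| + M * `|r - 1|) / e + M)%R.
have N0 : (0 <= `|a'| + M * `|r - 1|)%R by rewrite addr_ge0// mulr_ge0.
have B0 : (0 <= B)%R by rewrite addr_ge0// divr_ge0//; lra.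
have eB : (`|a'| + M * `|r - 1| + e * M = B * e)%R by rewrite /B mulrDl divfK ?gt_eqF// (mulrC M e).
have bound x px : x != r -> phi x = px%:E -> (a' - px <= B * `|x - r|)%R.
  move=> xr xpx; have [xe|xe] := ltP `|x - r|%R e.
    have := near_r _ xe; rewrite xpx lte_fin => ?.
    by apply: (@le_trans _ _ 0%R); [lra|rewrite mulr_ge0].
  have := hM x; rewrite xpx lee_fin => h1.
  have h2 : (M * `|x - 1| <= M * `|x - r| + M * `|r - 1|)%R.
    by rewrite -mulrDr ler_wpM2l//; apply: le_trans (ler_normD _ _); rewrite addrA subrK.
  have h3 := ler_norm a'.
  have h4 : (0 <= (B - M) * (`|x - r| - e))%R.
    by apply: mulr_ge0; [rewrite /B addrK divr_ge0//; lra|lra].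
  nra.
(* The element [- B] keeps [L] nonempty when [phi] is infinite everywhere to the left of [r]; by
   [bound] it is still below every chord slope on the right. *)
pose L := [set z : R | z = (- B)%R \/ exists x px,
  [/\ (x < r)%R, phi x = px%:E & z = ((a' - px) / (r - x))%R]].
have LB : ubound L B.
  move=> z [->|[x [px [xr xpx ->]]]]; first lra.
  rewrite ler_pdivrMr; last lra.
  have /bound/(_ xpx) : x != r by rewrite lt_eqF.
  by rewrite ltr0_norm ?opprB//; lra.
have L0 : L (- B)%R by left.
have supL : has_sup L by split; [exists (- B)%R | exists B].
exists (sup L) => x.
have [[px xpx]|->] := ereal_fin_or_pinfty x; last by rewrite leey.
rewrite xpx lee_fin.
have [xr|xr|xr] := ltgtP x r.
- have : ((a' - px) / (r - x) <= sup L)%R.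
    by apply: sup_upper_bound => //; right; exists x, px.
  by rewrite ler_pdivrMr; nra.
- suff : (sup L <= (px - a') / (x - r))%R by rewrite ler_pdivlMr; nra.
  apply: ge_sup; first by exists (- B)%R.
  move=> z [->|[w [pw [wr wpw ->]]]].
    have /bound/(_ xpx) : x != r by rewrite gt_eqF.
    by rewrite gtr0_norm ?ler_pdivlMr; lra.
  have h : (w < r < x)%R by lra.
  have := convex_three_points h wpw xpx (ltW a'r).
  by rewrite ler_pdivlMr ?ler_pdivrMr//; last lra; rewrite mulrAC ler_pdivrMr; nra.
- by move: a'r; rewrite -{}xr xpx lte_fin => ?; lra.
Qed.

(** Since [phi 1 = 0], these quotients are the slopes of the chords from [(1, 0)]. They are
    nondecreasing by convexity, so their supremum is their limit at infinity. *)
Let slope1 := ereal_sup [set phi x * ((x - 1)^-1)%:E | x in [set x | (1 < x)%R]].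

Let slope1_ge x : (1 < x)%R -> phi x <= slope1 * (x - 1)%:E.
Proof.
move=> x1; rewrite -lee_pdivrMr ?subr_gt0//.
by apply: ereal_sup_ubound; exists x.
Qed.

Let chord_extrapolate a : a%:E < slope1 -> exists2 x0, (1 < x0)%R &
  forall x, (x0 <= x)%R -> (a * (x - 1))%:E <= phi x.
Proof.
move=> /ereal_sup_gt[_ [x0 /= x01 <-]].
rewrite lte_pdivlMr ?subr_gt0// -EFinM => ax0.
exists x0 => // x; rewrite le_eqVlt => /orP[/eqP <-|x0x]; first exact: ltW.
have [[px xpx]|->] := ereal_fin_or_pinfty x; last by rewrite leey.
have h : (1 < x0 < x)%R by lra.
have := convex_three_points h phi1 xpx (ltW ax0).
by rewrite xpx lee_fin; nra.
Qed.

(** Replacing the denominator [x - 1] by [x] does not change the limit of the chord slopes, whether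
    it is finite or [+oo]. *)
Lemma slope_pinfty_cvg : phi x * (x^-1)%:E @[x --> +oo%R] --> slope1.
Proof.
have pinf (P : R -> Prop) (x0 : R) : (forall x, (x0 < x)%R -> P x) ->
    \forall x \near +oo%R, P x.
  by move=> h; exists x0; split; [exact: num_real|].
have ninf : -oo < slope1.
  apply: lt_le_trans (ereal_sup_ubound _) => /=; last first.
    by exists 2%R => //=; rewrite ltr1n.
  by rewrite ltNye; have [[a ->]|->] := ereal_fin_or_pinfty 2%R;
    rewrite //= gt0_mulye//; lra.
case E : slope1 ninf => [s| |] // _.
- have finx x : (1 < x)%R -> exists2 a, phi x = a%:E & (a <= s * (x - 1))%R.
    move=> /[dup] x1 /slope1_ge; rewrite E.
    by have [[a ->]|->] := ereal_fin_or_pinfty x => //; rewrite -EFinM lee_fin; exists a.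
  apply/fine_cvgP; split.
    by apply: (pinf _ 1%R) => x /finx[a -> _]; rewrite -EFinM.
  apply/cvgrPdist_le => e e0 /=.
  have /chord_extrapolate[x0 x01 hx0] : (s - e / 2)%:E < slope1.
    by rewrite E lte_fin; lra.
  have M0 : (0 <= (`|s| + e) / (e / 2))%R by rewrite divr_ge0 ?addr_ge0//; lra.
  (* The second summand forces [|s| + e <= x * (e / 2)], which absorbs the passage from [x - 1] to
     [x]; the first one makes the chord bound available. *)
  apply: (pinf _ (x0 + (`|s| + e) / (e / 2))%R) => x xx.
  have [x1 x0x] : (1 < x)%R /\ (x0 <= x)%R by lra.
  have [a xa als] := finx _ x1.
  have := hx0 _ x0x; rewrite xa lee_fin => alb.
  have : (`|s| + e <= x * (e / 2))%R by rewrite -ler_pdivrMr; lra.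
  have := ler_norm s; have := ler_norm (- s)%R; rewrite normrN => s1 s2 s3.
  have h1 : (a / x <= s + e)%R by rewrite ler_pdivrMr; nra.
  have h2 : (s - e <= a / x)%R by rewrite ler_pdivlMr; nra.
  by rewrite -EFinM/= ler_norml; apply/andP; split; lra.
- apply/cvgeyPge => A.
  have /chord_extrapolate[x0 x01 hx0] : (`|A| + 1)%:E < slope1.
    by rewrite E ltry.
  have := normr_ge0 A; have := ler_norm A => A1 A2.
  apply: (pinf _ (x0 + (`|A| + 1))%R) => x xx.
  have [x1 x0x] : (0 < x)%R /\ (x0 <= x)%R by lra.
  rewrite lee_pdivlMr//; apply: le_trans (hx0 _ x0x).
  by rewrite -EFinM lee_fin; nra.
Qed.

(** The graph lies below a line of slope [slope1] through [(1, 0)] to the right of 1, so a minorant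
    with a steeper slope would overtake it far enough out. *)
Lemma slope_pinfty_ge (y c : R) :
  (forall x, (0 <= x)%R -> (x * y - c)%:E <= phi x) -> y%:E <= slope_pinfty phi.
Proof.
move=> h; rewrite /slope_pinfty (cvg_lim _ slope_pinfty_cvg)//.
rewrite leNgt; apply/negP => ys.
have [s ss ys'] : exists2 s : R, slope1 <= s%:E & (s < y)%R.
  move: ys; case: slope1 => [s| |] //; first by rewrite lte_fin; exists s.
  by exists (y - 1)%R; [exact: leNye|lra].
(* Chosen so that [(x - 2) * (y - s) = |c - s|]; the extra 2 makes the contradiction strict and
   places [x] beyond 1. *)
pose x := (2 + `|(c - s)%R| / (y - s))%R.
have x1 : (2 <= x)%R by rewrite lerDl divr_ge0//; lra.
have : (x * y - c <= s * (x - 1))%R.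
  rewrite -lee_fin; apply: le_trans (h _ _) _; first lra.
  apply: le_trans (slope1_ge _) _; first lra.
  by rewrite EFinM lee_wpmul2r// lee_fin; lra.
have : ((x - 2) * (y - s) = `|c - s|)%R by rewrite /x addrC addKr divfK// lt0r_neq0//; lra.
by have := ler_norm (c - s)%R; nra.
Qed.

Lemma slope_pinfty_gtNy : -oo < slope_pinfty phi.
Proof.
have [y [c [h _]]] : exists y c : R, (forall x, (x * y - c)%:E <= phi x) /\
    (-1 < 1 * y - c)%R.
  by apply: affine_minorant_gt; rewrite phi1 lte_fin; lra.
by apply: lt_le_trans (slope_pinfty_ge (fun x _ => h x)); rewrite ltNyr.
Qed.

(** On the half-line [0 <= x], lowering the slope and raising the subtracted constant can only
    decrease an affine function. A real minorant can thus be perturbed into a rational one, and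
    rational pairs are countable. *)
Lemma countable_affine_minorants : exists q : nat -> R * R,
  (forall i x, (0 <= x)%R -> (x * (q i).1 - (q i).2)%:E <= phi x) /\
  forall x a, (0 <= x)%R -> a%:E < phi x ->
    exists i, (a < x * (q i).1 - (q i).2)%R.
Proof.
pose minor (p : rat * rat) := forall x : R, (0 <= x)%R ->
  (x * ratr p.1 - ratr p.2)%:E <= phi x.
have ratmin x a : (0 <= x)%R -> a%:E < phi x ->
    exists2 p, minor p & (a < x * ratr p.1 - ratr p.2)%R.
  move=> x0 /affine_minorant_gt[y [c [h axy]]].
  (* Perturbing both coefficients by less than [e] costs less than [e * x + e] at [x], which is
     exactly the available gap. *)
  pose e := ((x * y - c - a) / (x + 1))%R.
  have e0 : (0 < e)%R by rewrite divr_gt0; lra.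
  have ee : (e * x + e = x * y - c - a)%R.
    by rewrite -{2}(mulr1 e) -mulrDr /e divfK// lt0r_neq0//; lra.
  have [u /andP[u1 u2]] : exists u : rat, (y - e < ratr u < y)%R.
    have /rat_in_itvoo[u] : (y - e < y)%R by lra.
    by rewrite in_itv/=; exists u.
  have [v /andP[v1 v2]] : exists v : rat, (c < ratr v < c + e)%R.
    have /rat_in_itvoo[v] : (c < c + e)%R by lra.
    by rewrite in_itv/=; exists v.
  exists (u, v) => [t t0|] /=.
    by apply: le_trans (h t); rewrite lee_fin; nra.
  by nra.
(* [p0] is the default for indices that decode to no pair or to a pair that is not a minorant. *)
have [p0 mp0 _] : exists2 p, minor p & (-1 < 1 * ratr p.1 - ratr p.2 :> R)%R.
  by apply: ratmin => //; rewrite phi1 lte_fin; lra.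
pose p i := if @unpickle (rat * rat)%type i is Some p then
  if `[< minor p >] then p else p0 else p0.
exists (fun i => (ratr (p i).1, ratr (p i).2)); split=> [i|x a x0 /ratmin[]//q mq aq] /=.
  suff : minor (p i) by [].
  by rewrite /p; case: unpickle => // q; case: asboolP.
by exists (pickle q); rewrite /p pickleK; case: asboolP.
Qed.
End convex_real.

(** * Integrals of extended-valued functions with integrable minorants *)

Section integral_lemmas.
Context d (T : measurableType d) (R : realType).
Implicit Types (mu : {measure set T -> \bar R}) (f g : T -> \bar R).

(* The convention [oo - oo = -oo] keeps the integral monotone even when neither
   side is integrable. *)
Lemma le_integral_measurable mu f g : measurable_fun setT f ->
  measurable_fun setT g -> (forall x, f x <= g x) ->
  \int[mu]_x f x <= \int[mu]_x g x.
Proof.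
move=> mf mg fg; rewrite (integralE _ _ f) (integralE _ _ g) leeB//.
- apply: ge0_le_integral => //; [exact: measurable_funepos..|move=> x _].
  by apply: (@funepos_le _ _ setT) => [y _|]; [exact: fg|rewrite inE].
- apply: ge0_le_integral => //; [exact: measurable_funeneg..|move=> x _].
  by apply: (@funeneg_le _ _ setT) => [y _|]; [exact: fg|rewrite inE].
Qed.

(** The negative part of [f] is dominated by that of [g], so a finite upper bound on the integral
    controls the positive part too. *)
Lemma integrable_lower_bound mu f g : mu.-integrable setT g ->
  measurable_fun setT f -> (forall x, g x <= f x) -> \int[mu]_x f x < +oo ->
  mu.-integrable setT f.
Proof.
move=> ig mf gf foo; apply/integrableP; split => //.
have neg : \int[mu]_x f^\- x < +oo.
  apply: le_lt_trans (integrable_lty measurableT (integrable_funeneg measurableT ig)).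
  apply: ge0_le_integral => //; [exact: measurable_funeneg| |move=> x _].
    by apply: measurable_funeneg; exact: measurable_int ig.
  by apply: (@funeneg_le _ _ setT) => [y _|]; [exact: gf|rewrite inE].
have neg_fin : \int[mu]_x f^\- x \is a fin_num.
  by rewrite ge0_fin_numE//; apply: integral_ge0.
rewrite (eq_integral (f^\+ \+ f^\-)); last first.
  by move=> x _; rewrite -[RHS]/((f^\+ \+ f^\-) x) -fune_abse.
rewrite ge0_integralD//; [|exact: measurable_funepos|exact: measurable_funeneg].
apply: lte_add_pinfty => //.
by move: foo; rewrite integralE lteBlDr// => /lt_le_trans; apply; rewrite leey.
Qed.

Lemma integral_le_lower_boundD mu f (m : T -> R) :
  mu.-integrable setT (EFin \o m) -> measurable_fun setT f ->
  (forall x, (m x)%:E <= f x) ->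
  \int[mu]_x f x <= \int[mu]_x (m x)%:E + \int[mu]_x (f x - (m x)%:E).
Proof.
move=> im mf mlef.
have mm : measurable_fun setT (EFin \o m) by exact: measurable_int im.
have mfm : measurable_fun setT (fun x => f x - (m x)%:E).
  exact: emeasurable_funB.
have fin_m : \int[mu]_x (m x)%:E \is a fin_num by exact: integrable_fin_num.
have [foo|] := ltP (\int[mu]_x (f x - (m x)%:E)) +oo; last first.
  by rewrite leye_eq => /eqP ->; rewrite addey ?leey// -ltNye ltNye_eq fin_m.
rewrite -integralD//; last first.
  apply: integrable_lower_bound (integrable0 mu setT) mfm _ foo => x.
  by rewrite -[leLHS]/(0%E) sube_ge0.
by apply: le_integral_measurable => // [|x];
  [exact: emeasurable_funD|rewrite addeC subeK].
Qed.

(** The minorants exclude [-oo] for both integrals. If one of them is [+oo], so is the sum;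
    otherwise both functions are integrable and integrals add. *)
Lemma integral_le_add mu (h m1 m2 : T -> R) f g :
  mu.-integrable setT (EFin \o h) -> mu.-integrable setT (EFin \o m1) ->
  mu.-integrable setT (EFin \o m2) ->
  measurable_fun setT f -> measurable_fun setT g ->
  (forall x, (m1 x)%:E <= f x) -> (forall x, (m2 x)%:E <= g x) ->
  (forall x, (h x)%:E <= f x + g x) ->
  \int[mu]_x (h x)%:E <= \int[mu]_x f x + \int[mu]_x g x.
Proof.
move=> ih im1 im2 mf mg m1f m2g hfg.
have gtNy (m : T -> R) k : mu.-integrable setT (EFin \o m) ->
    measurable_fun setT k -> (forall x, (m x)%:E <= k x) -> -oo < \int[mu]_x k x.
  move=> im mk mlek.
  apply: lt_le_trans (le_integral_measurable mu (measurable_int _ im) mk mlek).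
  by rewrite ltNye_eq integrable_fin_num.
have fN := gtNy _ _ im1 mf m1f; have gN := gtNy _ _ im2 mg m2g.
have [foo|] := ltP (\int[mu]_x f x) +oo; last first.
  by rewrite leye_eq => /eqP ->; rewrite addye ?leey// -ltNye.
have [goo|] := ltP (\int[mu]_x g x) +oo; last first.
  by rewrite leye_eq => /eqP ->; rewrite addey ?leey// -ltNye.
have if_ := integrable_lower_bound im1 mf m1f foo.
have ig := integrable_lower_bound im2 mg m2g goo.
rewrite -integralD//; apply: le_integral_measurable => //.
  exact: measurable_int ih.
exact: emeasurable_funD.
Qed.

End integral_lemmas.

(** * Jordan parts of charges, in particular of nonnegative ones *)

Section nonneg_charges.
Context d (T : measurableType d) (R : realType).
Implicit Types (mu : {charge set T -> \bar R}) (A : set T) (h : T -> R).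

Lemma pos_partE mu A : measurable A -> pos_part mu A = mu (A `&` hahn_pos mu).
Proof.
move=> mA; have [[mP _] _ _ _] := hahnP mu.
by transitivity (crestr0 mu mP A) => //; rewrite /crestr0 mem_set.
Qed.

Lemma neg_partE mu A : measurable A -> neg_part mu A = - mu (A `&` hahn_neg mu).
Proof.
move=> mA; have [_ [mN _] _ _] := hahnP mu.
transitivity (cscale (-1) (crestr0 mu mN) A) => //.
by rewrite /cscale /= /crestr0 mem_set// mulN1e.
Qed.

Lemma total_variationE mu A : Defs.total_variation mu A = pos_part mu A + neg_part mu A.
Proof. by []. Qed.

Lemma abse_le_total_variation mu A : measurable A ->
  `|mu A| <= Defs.total_variation mu A.
Proof. exact: abse_charge_variation. Qed.

Lemma chargeE_parts mu A : measurable A -> mu A = pos_part mu A - neg_part mu A.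
Proof. by move=> mA; rewrite (jordan_decomp (hahnP mu) mA) /cadd/= cscaleN1. Qed.

Lemma nonneg_charge_neg_part mu A : nonneg_charge mu -> measurable A ->
  neg_part mu A = 0.
Proof.
move=> mu0 mA; have [_ [mN negN] _ _] := hahnP mu.
have mAN : measurable (A `&` hahn_neg mu) by exact: measurableI.
rewrite neg_partE//; apply/eqP; rewrite oppe_eq0 eq_le mu0// andbT.
by apply: negN => //; exact: subIsetr.
Qed.

Lemma nonneg_charge_pos_part mu A : nonneg_charge mu -> measurable A ->
  pos_part mu A = mu A.
Proof.
by move=> mu0 mA; rewrite [RHS]chargeE_parts// nonneg_charge_neg_part// sube0.
Qed.

Lemma integral_total_variation mu (f : T -> \bar R) :
  measurable_fun setT f -> (forall x, 0 <= f x) ->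
  \int[Defs.total_variation mu]_x f x =
    \int[pos_part mu]_x f x + \int[neg_part mu]_x f x.
Proof.
move=> mf f0; rewrite -ge0_integral_measure_add//.
by apply: eq_measure_integral => A mA _; rewrite [RHS]measure_addE.
Qed.

Lemma integrable_total_variation mu h :
  (Defs.total_variation mu).-integrable setT (EFin \o h) ->
  (pos_part mu).-integrable setT (EFin \o h) /\
  (neg_part mu).-integrable setT (EFin \o h).
Proof.
move=> /integrableP[mh]; rewrite integral_total_variation//; last first.
  exact: measurableT_comp.
have p0 : 0 <= \int[pos_part mu]_x `|(EFin \o h) x| by apply: integral_ge0.
have n0 : 0 <= \int[neg_part mu]_x `|(EFin \o h) x| by apply: integral_ge0.
move=> hoo; split; apply/integrableP; split => //; apply: le_lt_trans hoo.
  by rewrite leeDl.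
by rewrite leeDr.
Qed.

Lemma nonneg_charge_pairing mu h : nonneg_charge mu ->
  pairing mu h = (\int[pos_part mu]_x h x)%R.
Proof.
move=> mu0; rewrite /pairing [X in (_ - X)%R](_ : _ = 0%R) ?subr0//.
rewrite /Rintegral (@eq_measure_integral _ _ _ _ mzero) ?integral_measure_zero//.
by move=> A mA _; exact: nonneg_charge_neg_part.
Qed.

End nonneg_charges.

(** * Density and singular set of a nonnegative charge *)

Section density.
Local Open Scope charge_scope.
Context d (T : measurableType d) (R : realType).
Variables (mu : {charge set T -> \bar R}) (nu : {finite_measure set T -> \bar R}).
Hypothesis mu0 : nonneg_charge mu.

Let caddE (m1 m2 : {charge set T -> \bar R}) A :
  (cadd m1 m2 : {charge set T -> \bar R}) A = m1 A + m2 A.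
Proof. by []. Qed.

(** The two parts come from a choice. Absolute continuity kills the first on [S] and singularity
    kills the second off [S], so both are restrictions of [mu] and inherit its sign. *)
Lemma nonneg_lebesgue_decomposition : exists S, [/\ measurable S, nu S = 0,
  forall A, measurable A -> ac_part mu nu A = mu (A `&` ~` S) &
  forall A, measurable A -> sing_part mu nu A = mu (A `&` S)].
Proof.
have [/null_content_dominatesP ac [S [mS nuS tvS]] eqmu] :=
  lebesgue_decompositionP mu nu.
have acS A : measurable A -> ac_part mu nu (A `&` S) = 0.
  move=> mA; have mAS : measurable (A `&` S) by exact: measurableI.
  by apply: ac => //; exact: subset_measure0 nuS.
have singSC A : measurable A -> sing_part mu nu (A `&` ~` S) = 0.
  move=> mA; have mAS : measurable (A `&` ~` S).
    by apply: measurableI => //; exact: measurableC.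
  apply/eqP; rewrite -abse_eq0 eq_le abse_ge0 andbT.
  apply: le_trans (abse_le_total_variation _ mAS) _.
  by rewrite -tvS le_measure ?inE//; exact: measurableC.
have split (m : {charge set T -> \bar R}) A : measurable A ->
    m A = m (A `&` S) + m (A `&` ~` S).
  move=> mA; apply: charge_partition => //; first exact: measurableC.
    exact: setUv.
  exact: setICr.
exists S; split => // A mA; rewrite split//.
  rewrite acS// add0e eqmu; last by apply: measurableI => //; exact: measurableC.
  by rewrite caddE singSC// adde0.
rewrite singSC// adde0 eqmu; last exact: measurableI.
by rewrite caddE acS// add0e.
Qed.

(** Replaces the chosen decomposition and derivative by a set [S] and a real density [r] that is
    nonnegative everywhere, which evaluating [phi] on the half-line requires. *)
Lemma nonneg_phi_div : exists (S : set T) (r : T -> R),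
  [/\ measurable S, nu S = 0, forall x, (0 <= r x)%R,
    nu.-integrable setT (EFin \o r) &
    (forall phi : R -> \bar R, measurable_fun setT phi ->
      phi_div phi mu nu =
        \int[nu]_x phi (r x) + pos_part mu S * slope_pinfty phi) /\
    (forall h : T -> R, (pos_part mu).-integrable setT (EFin \o h) ->
      nu.-integrable setT (EFin \o (fun x => h x * r x)%R) /\
      \int[pos_part mu]_(x in ~` S) (h x)%:E = \int[nu]_x (h x * r x)%:E)].
Proof.
have [S [mS nuS acE singE]] := nonneg_lebesgue_decomposition.
have mSC : measurable (~` S) by exact: measurableC.
have [ac _ _] := lebesgue_decompositionP mu nu.
have ac0 : nonneg_charge (ac_part mu nu).
  by move=> A mA; rewrite acE// mu0//; exact: measurableI.
have sing0 : nonneg_charge (sing_part mu nu).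
  by move=> A mA; rewrite singE// mu0//; exact: measurableI.
pose P := pos_part mu; pose m := pos_part (ac_part mu nu).
have mE A : measurable A -> m A = P (A `&` ~` S).
  move=> mA; rewrite /m /P !nonneg_charge_pos_part ?acE//; exact: measurableI.
have mnu : m `<< nu by exact: jordan_pos_dominates.
pose f := Radon_Nikodym_SigmaFinite.f m nu.
have f0 x : 0 <= f x by exact: Radon_Nikodym_SigmaFinite.f_ge0.
have ffin x : f x \is a fin_num by exact: Radon_Nikodym_SigmaFinite.f_fin_num.
have intf : nu.-integrable setT f by exact: Radon_Nikodym_SigmaFinite.f_integrable.
have mf : measurable_fun setT f by exact: measurable_int intf.
have fr : EFin \o (fine \o f) = f by apply/funext => x /=; rewrite fineK.
have mD : measurable_fun setT ('d (ac_part mu nu) '/d nu).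
  by apply: measurable_int; exact: Radon_Nikodym_integrable.
(* Both functions have the same integral over every measurable set, so the everywhere nonnegative
   [f] can stand for the derivative in [phi_div]. *)
have fD : ae_eq nu setT f ('d (ac_part mu nu) '/d nu).
  apply: integral_ae_eq => // A _ mA.
  rewrite -Radon_Nikodym_integral// -Radon_Nikodym_SigmaFinite.f_integral//.
  by rewrite /m nonneg_charge_pos_part.
have mD_charge : ae_eq nu setT f ('d (charge_of_finite_measure m) '/d nu).
  exact: ae_eq_Radon_Nikodym_SigmaFinite.
(* [P] and [m] agree on subsets of the complement of [S], and [m] gives [S] no mass. *)
have int_m (g : T -> \bar R) : P.-integrable setT g ->
    m.-integrable setT g /\ \int[P]_(x in ~` S) g x = \int[m]_x g x.
  move=> ig; have mg : measurable_fun setT g by exact: measurable_int ig.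
  have mPC A : measurable A -> A `<=` ~` S -> P A = m A.
    by move=> mA AS; rewrite mE// setIidl.
  have mS0 : m S = 0 by rewrite mE// setICr measure0.
  have im : m.-integrable setT g.
    apply/integrableP; split => //.
    have /integrableP[_] := ig; apply: le_lt_trans.
    rewrite -(setUv S) ge0_integral_setU//; last 2 first.
    - by rewrite setUv; exact: measurableT_comp.
    - by apply/disj_setPS; rewrite setICr.
    rewrite (_ : \int[m]_(x in S) _ = 0) ?add0e.
      rewrite -(eq_measure_integral m mPC) ge0_subset_integral//.
        by rewrite setUv.
      by rewrite setUv; exact: measurableT_comp.
    rewrite null_set_integral//.
    by apply: measurable_funTS; exact: measurableT_comp.
  split => //; rewrite (eq_measure_integral m mPC).
  by rewrite [RHS](negligible_integral mS)// setTD.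
exists S, (fine \o f); split => //; first by move=> x; exact: fine_ge0.
  by rewrite fr.
split=> [phi mphi|h ih].
- rewrite /phi_div; rewrite nonneg_charge_neg_part// mul0e sube0.
  congr (_ + _ * _); last first.
    rewrite !nonneg_charge_pos_part// singE// setTI//.
  apply: ae_eq_integral => //.
  - by apply: measurableT_comp => //; exact: measurableT_comp.
  - by apply: measurableT_comp => //; exact: measurableT_comp.
  - by apply: filterS fD => x fDx xT /=; rewrite fDx.
- have [im ->] := int_m _ ih.
  have mh : measurable_fun setT (EFin \o h) by exact: measurable_int im.
  have eqhf : (fun x => (h x)%:E * f x) = EFin \o (fun x => h x * fine (f x))%R.
    by apply/funext => x /=; rewrite EFinM fineK.
  split.
    rewrite -eqhf; apply/integrableP; split; first exact: emeasurable_funM.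
    have /integrableP[_] := Radon_Nikodym_SigmaFinite.integrableM mnu
      (fun x => abse_ge0 (h x)%:E) measurableT (integrable_abse im).
    by under eq_integral do rewrite abseM abse_id -abseM.
  rewrite -(Radon_Nikodym_change_of_variables mnu)//.
  rewrite -[RHS]/(\int[nu]_x (EFin \o (fun x => h x * fine (f x))%R) x) -eqhf.
  apply/esym/ae_eq_integral => //; [exact: emeasurable_funM..|].
  exact: ae_eqe_mul2l.
Qed.
End density.

Lemma bounded_le (T : Type) (R : realType) (f : T -> R) (M : R) :
  (forall x, (`|f x| <= M)%R) -> [bounded f x | x in [set: T]].
Proof.
move=> fM; exists M; split; [exact: num_real|move=> z /ltW Mz x _].
exact: le_trans Mz.
Qed.

(** * Measurable choice of nearly optimal affine minorants *)

Section affine_selection.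
Context d (T : measurableType d) (R : realType).
Variables (nu : {finite_measure set T -> \bar R}) (phi : R -> \bar R).
Variables (r : T -> R) (q : nat -> R * R).
Hypothesis mphi : measurable_fun setT phi.
Hypothesis r0 : forall x, (0 <= r x)%R.
Hypothesis ir : nu.-integrable setT (EFin \o r).
Hypothesis q_minor : forall i x, (0 <= x)%R -> (x * (q i).1 - (q i).2)%:E <= phi x.
Hypothesis q_dense : forall x a, (0 <= x)%R -> a%:E < phi x ->
  exists i, (a < x * (q i).1 - (q i).2)%R.

Let v (p : R * R) x : R := (r x * p.1 - p.2)%R.

(* [sel n x] is a best affine minorant at [r x] among [q 0, ..., q n]. *)
Let sel := fix sel n x := if n is m.+1 then
  if (v (sel m x) x < v (q m.+1) x)%R then q m.+1 else sel m x else q 0%N.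

Let mr : measurable_fun setT r.
Proof. by apply/measurable_EFinP; exact: measurable_int ir. Qed.

Let measurable_sel n : measurable_fun setT (fun x => (sel n x).1) /\
  measurable_fun setT (fun x => (sel n x).2).
Proof.
elim: n => [|n [m1 m2]] /=; first by split; exact: measurable_cst.
have mb : measurable_fun setT (fun x => v (sel n x) x < v (q n.+1) x)%R.
  apply: measurable_fun_ltr; apply: measurable_funB => //;
    apply: measurable_funM => //; exact: measurable_cst.
split.
- rewrite (_ : (fun x => _) = fun x => if (v (sel n x) x < v (q n.+1) x)%R
    then (q n.+1).1 else (sel n x).1); last by apply/funext => x; case: ifP.
  by apply: measurable_fun_ifT => //; exact: measurable_cst.
- rewrite (_ : (fun x => _) = fun x => if (v (sel n x) x < v (q n.+1) x)%R
    then (q n.+1).2 else (sel n x).2); last by apply/funext => x; case: ifP.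
  by apply: measurable_fun_ifT => //; exact: measurable_cst.
Qed.

Let bounded_sel n : exists M : R, forall x, (`|(sel n x).1| <= M /\ `|(sel n x).2| <= M)%R.
Proof.
elim: n => [|n [M hM]] /=.
  exists (`|(q 0%N).1| + `|(q 0%N).2|)%R => _.
  by rewrite lerDl lerDr.
exists (M + (`|(q n.+1).1| + `|(q n.+1).2|))%R => x.
have [M1 M2] := hM x.
have M0 : (0 <= M)%R by exact: le_trans M1.
have := normr_ge0 (q n.+1).1; have := normr_ge0 (q n.+1).2.
by case: ifP => _ *; split; lra.
Qed.

Let integrable_sel n : [/\ nu.-integrable setT (EFin \o (fun x => r x * (sel n x).1)%R),
  nu.-integrable setT (EFin \o (fun x => (sel n x).2)) &
  nu.-integrable setT (EFin \o (fun x => v (sel n x) x))].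
Proof.
have [m1 m2] := measurable_sel n; have [M hM] := bounded_sel n.
have i1 : nu.-integrable setT (EFin \o (fun x => r x * (sel n x).1)%R).
  have := integrableMl measurableT ir m1; apply.
  by apply: (bounded_le (M := M)) => x; have [] := hM x.
have i2 : nu.-integrable setT (EFin \o (fun x => (sel n x).2)).
  apply: measurable_bounded_integrable => //.
    by rewrite -ge0_fin_numE//; exact: fin_num_measure.
  by apply: (bounded_le (M := M)) => x; have [] := hM x.
split => //; rewrite (_ : _ \o _ = (EFin \o (fun x => r x * (sel n x).1)%R) \-
  (EFin \o (fun x => (sel n x).2))); first exact: integrableB.
by apply/funext => x /=; rewrite /v EFinB.
Qed.

Let sel_nd x : {homo (fun n => v (sel n x) x) : m n / (m <= n)%N >-> (m <= n)%R}.
Proof.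
by apply/nondecreasing_seqP => n /=; case: ifPn => // /ltW.
Qed.

Let sel_ge n x : (v (q n) x <= v (sel n x) x)%R.
Proof. by case: n => //= n; case: ifPn => //; rewrite -leNgt. Qed.

(** By contradiction: if no [w n] had an integral above [a], monotone convergence would bound the
    integral of [phi (r x)] by [a]. *)
Lemma affine_selection (a : R) : a%:E < \int[nu]_x phi (r x) ->
  exists y c : T -> R, [/\ measurable_fun setT y, exists M, forall x, (`|y x| <= M)%R,
    nu.-integrable setT (EFin \o (fun x => r x * y x)%R),
    nu.-integrable setT (EFin \o c) &
    (forall x t, (0 <= t)%R -> (t * y x - c x)%:E <= phi t) /\
    a%:E < \int[nu]_x (r x * y x)%:E - \int[nu]_x (c x)%:E].
Proof.
move=> aphi; pose w n x := v (sel n x) x.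
have iw n : nu.-integrable setT (EFin \o w n) by have [] := integrable_sel n.
have sel_minor n x t : (0 <= t)%R -> (t * (sel n x).1 - (sel n x).2)%:E <= phi t.
  by elim: n => [|n IH] /= t0; [exact: q_minor|case: ifP => _; [exact: q_minor|exact: IH]].
have [n wn] : exists n, a%:E < \int[nu]_x (w n x)%:E.
  apply: contrapT => nex; have na n : ~ a%:E < \int[nu]_x (w n x)%:E.
    by move=> an; apply: nex; exists n.
  (* Subtracting the integrable [w 0] makes the nondecreasing sequence nonnegative, as monotone
     convergence demands. *)
  pose h n x := (w n x - w 0%N x)%:E.
  have h0 n x : 0 <= h n x by rewrite lee_fin subr_ge0; exact: sel_nd.
  have ih n : nu.-integrable setT (h n).
    rewrite (_ : h n = (EFin \o w n) \- (EFin \o w 0%N)); first exact: integrableB.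
    by apply/funext => x; rewrite /h EFinB.
  have mh n : measurable_fun setT (h n) by exact: measurable_int (ih n).
  have hnd x : {homo (h ^~ x) : m n / (m <= n)%N >-> m <= n}.
    by move=> m n mn; rewrite lee_fin lerB//; exact: sel_nd.
  have cvgh x : cvgn (h ^~ x) by exact: ereal_nondecreasing_is_cvgn.
  have limE x : limn (h ^~ x) = ereal_sup (range (h ^~ x)).
    by apply/cvg_lim => //; exact: ereal_nondecreasing_cvgn.
  have w0f x : (w 0%N x)%:E <= phi (r x) by exact: sel_minor.
  have mphir : measurable_fun setT (phi \o r) by exact: measurableT_comp.
  have w0fin : \int[nu]_x (w 0%N x)%:E \is a fin_num by exact: (integrable_fin_num measurableT (iw 0%N)).
  have : \int[nu]_x (phi (r x) - (w 0%N x)%:E) <= a%:E - \int[nu]_x (w 0%N x)%:E.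
    apply: (@le_trans _ _ (\int[nu]_x limn (h ^~ x))).
      apply: le_integral_measurable => [||x].
      - exact: emeasurable_funB mphir (measurable_int _ (iw 0%N)).
      - by apply: (emeasurable_fun_cvg h) => // x _; exact: cvgh.
      rewrite leeBlDr// limE leNgt; apply/negP => sup_lt.
      (* A limit strictly below [phi (r x)] is a real number [L]; by [q_dense] some minorant exceeds
         [L] at [r x], and [sel] does at least as well. *)
      have [L LE] : exists L, ereal_sup (range (h ^~ x)) + (w 0%N x)%:E = L%:E.
        have : 0 <= ereal_sup (range (h ^~ x)).
          by apply: le_trans (h0 0%N x) (ereal_sup_ubound _); exists 0%N.
        move: sup_lt; case: (ereal_sup _) => [s _ _| |//].
          by exists (s + w 0%N x)%R.
        by rewrite addye// => /lt_le_trans/(_ (leey _)); rewrite ltxx.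
      move: sup_lt; rewrite LE => /(q_dense (r0 x))[i].
      apply/negP; rewrite -leNgt; apply: le_trans (sel_ge i x) _.
      rewrite -lee_fin -LE -leeBlDr// -EFinB.
      by apply: ereal_sup_ubound; exists i.
    have cvgI := @cvg_monotone_convergence _ _ _ nu _ measurableT _ mh
      (fun n x _ => h0 n x) (fun x _ => hnd x).
    rewrite -(cvg_lim _ cvgI)//; apply: lime_le; first exact: cvgP cvgI.
    apply: nearW => n; rewrite integralB_EFin// leeB//.
    by rewrite leNgt; apply/negP; exact: na.
  rewrite leeBrDr// addeC => /(le_trans (integral_le_lower_boundD (iw 0%N) mphir w0f)).
  by rewrite leNgt aphi.
have [i1 i2 _] := integrable_sel n; have [M hM] := bounded_sel n.
exists (fun x => (sel n x).1), (fun x => (sel n x).2); split => //.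
- by have [] := measurable_sel n.
- by exists M => x; have [] := hM x.
- split; first by move=> x t; exact: sel_minor.
  by rewrite -integralB_EFin.
Qed.
End affine_selection.

(** * The conjugate of [phi] restricted to the half-line *)

Section conjugate.
Context (R : realType) (phi : R -> \bar R).
Hypothesis phi_ninfty : forall x, phi x != -oo.
Hypothesis phi1 : phi 1%R = 0.

Local Notation psi := (convex_conjugate (phi_plus phi)).

(** The point [t = 1], where [phi] vanishes, already gives this value. It supplies an integrable
    minorant [g + l] for the integral of [psi (g + l)]. *)
Lemma conjugate_plus_ge (y : R) : y%:E <= psi y.
Proof.
apply: ereal_sup_ubound; exists 1%R => //.
by rewrite /phi_plus ler01 phi1 sube0 mul1r.
Qed.

Lemma conjugate_plus_young (t y : R) : (0 <= t)%R -> (t * y)%:E <= phi t + psi y.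
Proof.
move=> t0; have psiN : psi y != -oo.
  by rewrite -ltNye; apply: lt_le_trans (conjugate_plus_ge y); rewrite ltNyr.
have [[p tp]|->] := ereal_fin_or_pinfty phi_ninfty t; last by rewrite addye ?leey.
rewrite tp addeC -leeBlDr//; apply: ereal_sup_ubound; exists t => //.
by rewrite /phi_plus t0 tp.
Qed.

Lemma conjugate_plus_le (y c : R) :
  (forall t, (0 <= t)%R -> (t * y - c)%:E <= phi t) -> psi y <= c%:E.
Proof.
move=> h; apply: ge_ereal_sup => _ [t _ <-]; rewrite /phi_plus.
case: ifPn => [t0|_]; last by rewrite addeNy leNye.
have := h _ t0; have [[p ->]|->] := ereal_fin_or_pinfty phi_ninfty t.
  by rewrite -EFinB !lee_fin; lra.
by rewrite addeNy leNye.
Qed.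

(** A supremum of continuous affine functions is lower semicontinuous; points where [phi_plus] is
    [+oo] contribute only [-oo]. *)
Lemma conjugate_plus_measurable : measurable_fun setT psi.
Proof.
apply: lower_semicontinuous_measurable => y a /ereal_sup_gt[_ [t _ <-]].
have : phi_plus phi t = +oo \/ exists p, phi_plus phi t = p%:E.
  rewrite /phi_plus; case: ifP => _; last by left.
  by have [[p ->]|->] := ereal_fin_or_pinfty phi_ninfty t; [right; exists p|left].
case=> [->|[p tp]]; first by rewrite addeNy.
rewrite tp -EFinB lte_fin => atp.
have cv : (t * z - p)%R @[z --> y] --> (t * y - p)%R.
  by apply: cvgB; [apply: cvgMr; exact: cvg_id|exact: cvg_cst].
exists [set z | (a < t * z - p)%R]; first exact: cvgr_gt cv _ atp.
move=> z /= az; apply: lt_le_trans (ereal_sup_ubound _); last by exists t.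
by rewrite tp -EFinB lte_fin.
Qed.

End conjugate.

(** * The essential supremum modulo the common null sets *)

Section essential_range.
Context d (T : measurableType d) (R : realType).
Variables (X : set ({charge set T -> \bar R})).
Local Notation Xi := (common_null_ideal X).

Lemma common_null_ideal0 : Xi set0.
Proof. by split => // mu _; exact: measure0. Qed.

Lemma common_null_ideal_bigcup (F : nat -> set T) :
  (forall i, Xi (F i)) -> Xi (\bigcup_i F i).
Proof.
move=> XiF; have mF : measurable (\bigcup_i F i).
  by apply: bigcupT_measurable => i; have [] := XiF i.
split => // mu Xmu; apply/negligibleP => //; apply: negligible_bigcup => i.
by have [mFi /(_ _ Xmu) ?] := XiF i; apply/negligibleP.
Qed.

(** Every value outside the essential range lies in a rational interval with null preimage. There
    are countably many such intervals, so the union of these preimages is an admissible [N]. *)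
Lemma le_ess_sup_mod (g : T -> R) : measurable_fun setT g ->
  exists2 N, Xi N & forall x, ~ N x -> (g x)%:E <= ess_sup_mod Xi g.
Proof.
move=> mg.
pose pre (p : rat * rat) := g @^-1` `](ratr p.1 : R), (ratr p.2 : R)[%classic.
have mpre p : measurable (pre p) by rewrite -[pre p]setTI; exact: mg.
pose F i := if @unpickle (rat * rat)%type i is Some p then
  if `[< Xi (pre p) >] then pre p else set0 else set0.
exists (\bigcup_i F i) => [|x Nx].
  apply: common_null_ideal_bigcup => i; rewrite /F.
  case: unpickle => [p|]; last exact: common_null_ideal0.
  by case: asboolP => // _; exact: common_null_ideal0.
rewrite leNgt; apply/negP => gx; apply: Nx.
have : ~ ess_im Xi g (g x).
  by move=> im; move: gx; rewrite ltNge => /negP; apply; apply: ereal_sup_ubound; exists (g x).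
move=> /existsNP[e /not_implyP[e0 /contrapT[_ Xie]]].
have /rat_in_itvoo[u] : (g x - e < g x)%R by rewrite ltrBlDr ltrDl.
have /rat_in_itvoo[v] : (g x < g x + e)%R by rewrite ltrDl.
rewrite !in_itv/= => /andP[v1 v2] /andP[u1 u2].
exists (pickle (u, v)); first exact: I.
rewrite /F pickleK.
case: asboolP => [_|]; first by rewrite /pre /= in_itv/= u2.
case; split => // mu Xmu.
apply: (subset_measure0 _ _ _ (Xie _ Xmu)) => //.
  by rewrite -[X in measurable X]setTI; exact: mg.
move=> z; rewrite /pre /= !in_itv/= => /andP[z1 z2].
by rewrite (lt_trans u1 z1) (lt_trans z2 v2).
Qed.

Lemma ess_sup_mod_le (g : T -> R) (s : \bar R) :
  (forall x, (g x)%:E <= s) -> ess_sup_mod Xi g <= s.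
Proof.
move=> gs; apply: ge_ereal_sup => _ [y imy <-]; rewrite leNgt; apply/negP => sy.
have [e e0 es] : exists2 e : R, (0 < e)%R & s <= (y - e)%:E.
  move: sy; case: s {gs} => [s| |] //; last by exists 1%R; rewrite ?leNye.
  by rewrite lte_fin => sy; exists (y - s)%R; [lra|rewrite lee_fin; lra].
apply: (imy _ e0); rewrite (_ : _ @^-1` _ = set0); first exact: common_null_ideal0.
apply/seteqP; split => // x /=; rewrite in_itv/= => /andP[+ _].
by apply/negP; rewrite -leNgt -lee_fin; exact: le_trans (gs x) es.
Qed.

Lemma bounded_Linfty (g : T -> R) (M : R) : measurable_fun setT g ->
  (forall x, (`|g x| <= M)%R) -> Linfty Xi g.
Proof.
move=> mg gM; split => //.
exists M; split; [exact: num_real|move=> z Mz y imy /=].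
rewrite leNgt; apply/negP => zy.
have e0 : (0 < `|y| - M)%R by lra.
apply: (imy _ e0); rewrite (_ : _ @^-1` _ = set0); first exact: common_null_ideal0.
apply/seteqP; split => // x /=; rewrite in_itv/= => /andP[x1 x2].
have := gM x; have : (`|y| <= `|g x| + `|g x - y|)%R.
  by rewrite -[X in (`|X| <= _)%R](subKr (g x)); exact: ler_normB.
have : (`|g x - y| < `|y| - M)%R by rewrite ltr_norml; apply/andP; split; lra.
by lra.
Qed.

End essential_range.

(** * Both inequalities between the divergence and its dual expression *)

Section duality.
Context d (T : measurableType d) (R : realType).
Variables (phi : R -> \bar R) (nu : probability T R).
Hypothesis phi_ninfty : forall x, phi x != -oo.
Hypothesis phi_convex : convex_ereal phi.
Hypothesis phi_lsc : lower_semicontinuous phi.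
Hypothesis phi1 : phi 1%R = 0.
Hypothesis phi_dom : \forall x \near (1%R : R), phi x < +oo.
Variables (X : set ({charge set T -> \bar R})) (Y : set (T -> R)).
Hypothesis decXY : decomposable nu X Y.

Implicit Types (mu : {charge set T -> \bar R}) (g : T -> R).

Local Notation psi := (convex_conjugate (phi_plus phi)).
Local Notation slope := (slope_pinfty phi).
Local Notation Xi := (common_null_ideal X).

Let slopeNy : -oo < slope.
Proof. exact: slope_pinfty_gtNy. Qed.

Let mphi : measurable_fun setT phi.
Proof. exact: lower_semicontinuous_measurable. Qed.

Let mpsi : measurable_fun setT psi.
Proof. exact: conjugate_plus_measurable. Qed.

Let minor1 : exists p : R * R, forall x, (x * p.1 - p.2)%:E <= phi x.
Proof.
have : (-1)%:E < phi 1%R by rewrite phi1 lte_fin; lra.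
move=> /(affine_minorant_gt phi_ninfty phi_convex phi1 phi_dom phi_lsc)[y [c [h _]]].
by exists (y, c).
Qed.

Let integrable_affine (r : T -> R) y c : nu.-integrable setT (EFin \o r) ->
  nu.-integrable setT (EFin \o (fun x => r x * y - c)%R).
Proof.
move=> ir; rewrite (_ : _ \o _ = ((EFin \o r) \* cst y%:E) \- cst c%:E).
  apply: integrableB => //; first exact: integrableZr.
  exact: finite_measure_integrable_cst.
by apply/funext => x /=; rewrite EFinB EFinM.
Qed.

Let integral_phiNy (r : T -> R) : nu.-integrable setT (EFin \o r) ->
  -oo < \int[nu]_x phi (r x).
Proof.
move=> ir; have [[y c] /= h] := minor1.
have ia := integrable_affine y c ir.
have mr : measurable_fun setT r by apply/measurable_EFinP; exact: measurable_int ir.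
apply: lt_le_trans (le_integral_measurable nu (measurable_int _ ia) _ _).
- by rewrite ltNye_eq integrable_fin_num.
- exact: measurableT_comp.
- by move=> x; exact: h.
Qed.

Let mulslopeNy (x : \bar R) : 0 <= x -> x \is a fin_num -> -oo < x * slope.
Proof.
rewrite le_eqVlt => /orP[/eqP <-|x0]; first by rewrite mul0e ltNyr.
case: x x0 => // x x0 _; move: slopeNy; case: slope => [s| |] // _.
  by rewrite -EFinM ltNyr.
by rewrite gt0_muley.
Qed.

Lemma phi_div_gtNy mu : nonneg_charge mu -> -oo < phi_div phi mu nu.
Proof.
move=> mu0; have [S [r [mS nuS r0 ir [-> // _]]]] := nonneg_phi_div nu mu0.
have := integral_phiNy ir; 
have := mulslopeNy (measure_ge0 (pos_part mu) S) (fin_num_measure _ _ mS).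
by rewrite !ltNye => ? ?; rewrite adde_eq_ninfty negb_or; apply/andP.
Qed.

Lemma integrable_pos_part mu g : X mu -> Y g ->
  (pos_part mu).-integrable setT (EFin \o g).
Proof.
move=> Xmu Yg; have D := decomposable_duality decXY.
by have [] := integrable_total_variation (duality_integrable D Xmu Yg).
Qed.

Let pos_part_nu A : measurable A -> pos_part (charge_of_finite_measure nu) A = nu A.
Proof. by move=> mA; rewrite nonneg_charge_pos_part. Qed.

Lemma integrable_base g : Y g -> nu.-integrable setT (EFin \o g).
Proof.
move=> /(integrable_pos_part (decomposable_nu decXY))/integrableP[mg].
rewrite (eq_measure_integral nu); last by move=> A mA _; exact: pos_part_nu.
by move=> goo; apply/integrableP.
Qed.

Let pos_part_prob mu : prob_charge mu -> pos_part mu setT = 1.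
Proof. by case=> mu0 muT; rewrite nonneg_charge_pos_part. Qed.

Lemma pairing_prob mu g : prob_charge mu ->
  (pos_part mu).-integrable setT (EFin \o g) ->
  (pairing mu g)%:E = \int[pos_part mu]_x (g x)%:E.
Proof.
move=> [mu0 _] ig; rewrite nonneg_charge_pairing// /Rintegral fineK//.
exact: integrable_fin_num.
Qed.

(** The divergence and the integral of [psi] may both be [+oo]; keeping them on the same side avoids
    subtracting infinities. *)
Lemma pairing_le mu g l : X mu -> prob_charge mu -> Y g ->
  l%:E + ess_sup_mod Xi g <= slope ->
  (pairing mu g + l)%:E <= phi_div phi mu nu + \int[nu]_x psi (g x + l)%R.
Proof.
move=> Xmu pmu Yg lg; have [mu0 _] := pmu.
have [S [r [mS nuS r0 ir [divE covE]]]] := nonneg_phi_div nu mu0.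
rewrite divE//.
pose P := pos_part mu; pose h x := (g x + l)%R.
have ig := integrable_pos_part Xmu Yg.
have ign := integrable_base Yg.
have mg : measurable_fun setT g by apply/measurable_EFinP; exact: measurable_int ig.
have hE : EFin \o h = (EFin \o g) \+ cst l%:E by apply/funext => x /=; rewrite EFinD.
have ih : P.-integrable setT (EFin \o h).
  by rewrite hE; apply: integrableD => //; exact: finite_measure_integrable_cst.
have ihn : nu.-integrable setT (EFin \o h).
  by rewrite hE; apply: integrableD => //; exact: finite_measure_integrable_cst.
have mh : measurable_fun setT (EFin \o h) by exact: measurable_int ih.
(* Total mass 1 turns the constant [l] into part of the integrand. *)
have -> : (pairing mu g + l)%:E = \int[P]_x (h x)%:E.
  rewrite -[RHS]/(\int[P]_x (EFin \o h) x) hE integralD//; last first.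
    exact: finite_measure_integrable_cst.
  by rewrite integral_cst// [X in _ + _ * X](pos_part_prob pmu) mule1 EFinD (pairing_prob pmu ig).
have mSC : measurable (~` S) by exact: measurableC.
have -> : \int[P]_x (h x)%:E = \int[P]_(x in S) (h x)%:E + \int[P]_(x in ~` S) (h x)%:E.
  rewrite -(setUv S) integral_setU//; first by rewrite setUv.
  by apply/disj_setPS; rewrite setICr.
have [ihr ->] := covE h ih.
rewrite [leRHS]addeAC [leRHS]addeC; apply: leeD; last first.
  have [[y c] /= hyc] := minor1.
  have := @integral_le_add _ _ _ nu _ _ _ (phi \o r) (psi \o h) ihr
    (integrable_affine y c ir) ihn.
  apply => //.
  - apply: measurableT_comp => //.
    by apply/measurable_EFinP; exact: measurable_int ir.
  - by apply: measurableT_comp => //; exact: measurable_funD.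
  - by move=> x; exact: conjugate_plus_ge.
  - by move=> x; rewrite mulrC; exact: conjugate_plus_young.
(* The constraint on [g] holds pointwise only off a set [N] in the null ideal. As [mu] is in [X],
   its positive part does not charge [N], and [S] may be replaced by [S] minus [N]. *)
have [N [mN XiN] hN] := le_ess_sup_mod X mg.
have PN : P N = 0.
  by apply/eqP; rewrite -measure_le0 -(XiN _ Xmu) total_variationE leeDl.
have hslope x : ~ N x -> (h x)%:E <= slope.
  by move=> /hN gx; apply: le_trans lg; rewrite /h EFinD addeC leeD2l.
have PSN : P (S `\` N) = P S.
  have mI : measurable (S `&` N) by exact: measurableI.
  have PI : P (S `&` N) = 0 by apply: subset_measure0 PN.
  by rewrite [RHS](measureDI P mS mN) [X in _ = _ + X]PI adde0.
have mSN : measurable (S `\` N) by exact: measurableD.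
rewrite (negligible_integral mN mS (integrableS measurableT mS _ ih))// -PSN.
case: slope slopeNy hslope => [s| |] // _ hslope.
- rewrite muleC -integral_cst//; apply: le_integral => //.
  + exact: integrableS ih.
  + exact: finite_measure_integrable_cst.
  + by move=> x; rewrite inE => -[_ Nx]; exact: hslope.
(* For an infinite slope, either the singular part has no mass and both sides vanish, or the right
   side is [+oo]. *)
- have [P0|PS] := eqVneq (P (S `\` N)) 0; last first.
    by rewrite gt0_muley ?leey// lt_neqAle eq_sym PS measure_ge0.
  by rewrite P0 mul0e null_set_integral//; exact: measurable_funTS.
Qed.

(* The test function is set to [b] on a [nu]-null set carrying the singular part;
   [psi] is not integrated there, so [b <= slope] is the only constraint. *)
Let singular_level (I p : \bar R) (a : R) : -oo < I -> 0 <= p -> p \is a fin_num ->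
  a%:E < I + p * slope ->
  exists a' b : R, [/\ a'%:E < I, b%:E <= slope & (a <= a' + b * fine p)%R].
Proof.
move=> IN; case: p => // p; rewrite lee_fin le_eqVlt => /orP[/eqP <-|p0] _ /=.
  rewrite mul0e adde0 => aI; have [b bs] : exists b, b%:E <= slope.
    move: slopeNy; case: slope => [s| |] // _; first by exists s.
    by exists 0%R; rewrite leey.
  by exists a, b; split => //; rewrite mulr0 addr0.
case: slope slopeNy => [s| |] // _.
  rewrite -EFinM -lteBlDr// -EFinB => aI.
  by exists (a - p * s)%R, s; split => //; rewrite mulrC subrK.
move=> _; have [a' a'I] : exists a', a'%:E < I.
  case: I IN => [i| |] // _; last by exists 0%R; rewrite ltry.
  by exists (i - 1)%R; rewrite lte_fin; lra.
exists a', ((a - a') / p)%R; split => //; first by rewrite leey.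
by rewrite divfK ?gt_eqF// addrC subrK.
Qed.

(** The real bound [k] on the integral of [psi (g x)] keeps the last inequality between reals. The
    pointwise bound on [g] makes the shift [l = 0] admissible. *)
Lemma phi_div_approx mu (a : R) : X mu -> prob_charge mu ->
  a%:E < phi_div phi mu nu ->
  exists g k, [/\ Y g, forall x, (g x)%:E <= slope,
    \int[nu]_x psi (g x) <= k%:E & (a < pairing mu g - k)%R].
Proof.
move=> Xmu pmu; have [mu0 _] := pmu.
have [S [r [mS nuS r0 ir [divE covE]]]] := nonneg_phi_div nu mu0.
rewrite divE//; set P := pos_part mu => aD.
have PSfin : P S \is a fin_num by exact: fin_num_measure.
have [a' [b [a'I bs ab]]] :=
  singular_level (integral_phiNy ir) (measure_ge0 P S) PSfin aD.
have [q [q_minor q_dense]] :=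
  countable_affine_minorants phi_ninfty phi_convex phi1 phi_dom phi_lsc.
have [y [c [my [M yM] iry ic [minor a'lt]]]] :=
  affine_selection mphi r0 ir q_minor q_dense a'I.
pose g x := (b * \1_S x + y x * \1_(~` S) x)%R.
have mSC : measurable (~` S) by exact: measurableC.
have gS x : S x -> g x = b.
  by move=> Sx; rewrite /g !indicE mem_set// memNset ?mulr1 ?mulr0 ?addr0//; exact: contra_notT.
have gSC x : ~ S x -> g x = y x.
  by move=> Sx; rewrite /g !indicE memNset// mem_set// mulr1 mulr0 add0r.
have mg : measurable_fun setT g.
  apply: measurable_funD; apply: measurable_funM => //; exact: measurable_indic.
have gM x : (`|g x| <= `|b| + M)%R.
  have := yM x; have := normr_ge0 b; have := normr_ge0 (y x).
  by have [/gS ->|/gSC ->] := pselect (S x); lra.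
(* Each [y x] is the slope of an affine minorant on the half-line. *)
have yslope x : (y x)%:E <= slope.
  by apply: slope_pinfty_ge phi1 _ (c x) _ => //; exact: minor.
have Yg : Y g by apply: (decomposable_Linfty decXY); exact: bounded_Linfty gM.
have ig := integrable_pos_part Xmu Yg.
have aeS (f1 f2 : T -> \bar R) : (forall x, ~ S x -> f1 x = f2 x) -> ae_eq nu setT f1 f2.
  by move=> f12; exists S; split => // x /= /not_implyP[_ f1x]; apply: contrapT => /f12.
(* The intercept [c x] dominates [psi (y x)], and the values of [g] on [S] are invisible to [nu]. *)
exists g, (fine (\int[nu]_x (c x)%:E)); split => //.
- by move=> x; have [/gS ->|/gSC ->] := pselect (S x).
- rewrite fineK ?integrable_fin_num//.
  rewrite (ae_eq_integral (fun x => psi (y x)))//.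
  + apply: le_integral_measurable => //.
    * exact: measurableT_comp.
    * exact: measurable_int ic.
    * by move=> x; apply: conjugate_plus_le => // t; exact: minor.
  + exact: measurableT_comp.
  + exact: measurableT_comp.
  + by apply: aeS => x /gSC ->.
- have [igr cov] := covE g ig.
  rewrite -lte_fin EFinB fineK ?integrable_fin_num// pairing_prob//.
  have -> : \int[pos_part mu]_x (g x)%:E = b%:E * P S + \int[nu]_x (r x * y x)%:E.
    rewrite -[in LHS](setUv S) integral_setU//; last 2 first.
    + by rewrite setUv; exact/measurable_EFinP.
    + by apply/disj_setPS; rewrite setICr.
    congr (_ + _).
      rewrite -integral_cst//; apply: eq_integral => x; rewrite inE => Sx.
      by rewrite gS.
    rewrite cov; apply: (ae_eq_integral (EFin \o (fun x => r x * y x)%R)) => //.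
    + exact: measurable_int igr.
    + exact: measurable_int iry.
    + by apply: aeS => x /gSC ->; rewrite mulrC.
  rewrite -addeA -(fineK PSfin) -EFinM; apply: le_lt_trans (_ : (a' + b * fine (P S))%:E < _).
    by rewrite lee_fin.
  by rewrite EFinD addeC lteD2lE.
Qed.

End duality.

(** * Linearity of the pairing in the charge *)

Section pairing_linear.
Context d (T : measurableType d) (R : realType).
Implicit Types (m : {charge set T -> \bar R}) (P N M : {measure set T -> \bar R}).
Implicit Types (h : T -> R).

Let integral_mscale M (k : {nonneg R}) h : M.-integrable setT (EFin \o h) ->
  (mscale k M).-integrable setT (EFin \o h) /\
  (\int[mscale k M]_x h x = k%:num * \int[M]_x h x)%R.
Proof.
move=> ih; have mh : measurable_fun setT (EFin \o h) by exact: measurable_int ih.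
have ifin : \int[M]_x (h x)%:E \is a fin_num by exact: integrable_fin_num.
split.
  apply/integrableP; split => //.
  rewrite ge0_integral_mscale//; last exact: measurableT_comp.
  by apply: lte_mul_pinfty => //; have /integrableP[] := ih.
transitivity (fine ((k%:num)%:E * \int[M]_x (h x)%:E)); last by rewrite fineM.
congr fine; rewrite -[LHS]/(\int[mscale k M]_x (EFin \o h) x).
rewrite -[X in _ * X]/(\int[M]_x (EFin \o h) x) (integralE (mscale k M)) (integralE M).
have mp := measurable_funepos mh; have mn := measurable_funeneg mh.
rewrite (ge0_integral_mscale M measurableT k mp)//.
rewrite (ge0_integral_mscale M measurableT k mn)//.
have pfin := integrable_fin_num measurableT (integrable_funepos measurableT ih).
have nfin := integrable_fin_num measurableT (integrable_funeneg measurableT ih).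
move: pfin nfin; case: (\int[M]_x (EFin \o h)^\+ x) => // p _.
case: (\int[M]_x (EFin \o h)^\- x) => // n _ /=.
exact: (congr1 EFin (esym (mulrBr _ _ _))).
Qed.

Let integral_add M N h : M.-integrable setT (EFin \o h) ->
  N.-integrable setT (EFin \o h) ->
  (measure_add M N).-integrable setT (EFin \o h) /\
  (\int[measure_add M N]_x h x = \int[M]_x h x + \int[N]_x h x)%R.
Proof.
move=> iM iN; have mh : measurable_fun setT (EFin \o h) by exact: measurable_int iM.
split; last first.
  rewrite -fineD ?integrable_fin_num//; congr fine.
  exact: (integral_measure_add measurableT iM iN).
apply/integrableP; split => //.
rewrite ge0_integral_measure_add//; last exact: measurableT_comp.
by apply: lte_add_pinfty; [have /integrableP[] := iM|have /integrableP[] := iN].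
Qed.

(** The hypothesis says that [P - N] is [m], written with sums so that only measures occur;
    integrating [h] against both sums gives the claim. *)
Let pairing_repr m P N h :
  (pos_part m).-integrable setT (EFin \o h) ->
  (neg_part m).-integrable setT (EFin \o h) ->
  P.-integrable setT (EFin \o h) -> N.-integrable setT (EFin \o h) ->
  (forall A, measurable A -> pos_part m A + N A = P A + neg_part m A) ->
  pairing m h = (\int[P]_x h x - \int[N]_x h x)%R.
Proof.
move=> ipm inm iP iN e.
have : (\int[measure_add (pos_part m) N]_x h x =
       \int[measure_add P (neg_part m)]_x h x)%R.
  congr fine; apply: eq_measure_integral => A mA _.
  by rewrite [LHS]measure_addE [RHS]measure_addE; exact: e.
rewrite (integral_add ipm iN).2 (integral_add iP inm).2 /pairing; lra.
Qed.

(** Jordan parts are not additive, so the scaled and added parts of [m1] and [m2] serve only as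
    another representation of [m] as a difference of measures. *)
Lemma pairing_linear (a : R) m m1 m2 h :
  eq_charge m (cadd (cscale a m1) m2) ->
  (Defs.total_variation m).-integrable setT (EFin \o h) ->
  (Defs.total_variation m1).-integrable setT (EFin \o h) ->
  (Defs.total_variation m2).-integrable setT (EFin \o h) ->
  pairing m h = (a * pairing m1 h + pairing m2 h)%R.
Proof.
move=> em /integrable_total_variation[ip inn] /integrable_total_variation[ip1 in1].
move=> /integrable_total_variation[ip2 in2].
have parts A : measurable A -> exists p n p1 n1 p2 n2 : R,
    [/\ pos_part m A = p%:E, neg_part m A = n%:E, pos_part m1 A = p1%:E &
    [/\ neg_part m1 A = n1%:E, pos_part m2 A = p2%:E, neg_part m2 A = n2%:E &
     (p - n = a * (p1 - n1) + (p2 - n2))%R]].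
  move=> mA; have := em A mA; rewrite [RHS]/(a%:E * m1 A + m2 A).
  rewrite !chargeE_parts//.
  have fin (M : {finite_measure set T -> \bar R}) : exists x, M A = x%:E.
    by have /fineK <- := fin_num_measure M A mA; exists (fine (M A)).
  have [p pE] := fin (pos_part m); have [n nE] := fin (neg_part m).
  have [p1 p1E] := fin (pos_part m1); have [n1 n1E] := fin (neg_part m1).
  have [p2 p2E] := fin (pos_part m2); have [n2 n2E] := fin (neg_part m2).
  rewrite pE nE p1E n1E p2E n2E => -[e].
  by exists p, n, p1, n1, p2, n2.
have [a0|a0] := leP 0%R a.
- pose k := NngNum a0.
  have [sp1 sp1E] := integral_mscale k ip1; have [sn1 sn1E] := integral_mscale k in1.
  have [sP PE] := integral_add sp1 ip2; have [sN NE] := integral_add sn1 in2.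
  rewrite (pairing_repr ip inn sP sN) ?PE ?NE ?sp1E ?sn1E /=.
    by rewrite /pairing; ring.
  move=> A /parts[p [n [p1 [n1 [p2 [n2 [E1 E2 E3 [E4 E5 E6 e]]]]]]]].
  rewrite [X in _ + X = _]measure_addE [X in _ = X + _]measure_addE.
  rewrite -[LHS]/(pos_part m A + (a%:E * neg_part m1 A + neg_part m2 A)).
  rewrite -[RHS]/(a%:E * pos_part m1 A + pos_part m2 A + neg_part m A).
  by rewrite E1 E2 E3 E4 E5 E6 -!EFinM -!EFinD; congr EFin; lra.
(* A negative factor exchanges the roles of the two parts of [m1]. *)
- have a0' : (0 <= - a)%R by lra.
  pose k := NngNum a0'.
  have [sp1 sp1E] := integral_mscale k in1; have [sn1 sn1E] := integral_mscale k ip1.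
  have [sP PE] := integral_add sp1 ip2; have [sN NE] := integral_add sn1 in2.
  rewrite (pairing_repr ip inn sP sN) ?PE ?NE ?sp1E ?sn1E /=.
    by rewrite /pairing; ring.
  move=> A /parts[p [n [p1 [n1 [p2 [n2 [E1 E2 E3 [E4 E5 E6 e]]]]]]]].
  rewrite [X in _ + X = _]measure_addE [X in _ = X + _]measure_addE.
  rewrite -[LHS]/(pos_part m A + ((- a)%:E * pos_part m1 A + neg_part m2 A)).
  rewrite -[RHS]/((- a)%:E * neg_part m1 A + pos_part m2 A + neg_part m A).
  by rewrite E1 E2 E3 E4 E5 E6 -!EFinM -!EFinD; congr EFin; lra.
Qed.

End pairing_linear.

(** * Continuous functionals and closedness of the set of probabilities *)

Section compatible_topology.
Context d (T : measurableType d) (R : realType) (nu : probability T R).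
Variables (X : set ({charge set T -> \bar R})) (Y : set (T -> R)).
Hypothesis decXY : decomposable nu X Y.

Lemma indic_in_function_space A : measurable A -> Y (\1_A : T -> R).
Proof.
move=> mA; apply: (decomposable_Linfty decXY).
apply: (bounded_Linfty _ (M := 1%R)); first exact: measurable_indic.
by move=> x; rewrite indicE; case: (_ \in _); rewrite ?normr1 ?normr0.
Qed.

Lemma pairing_indic (mu : {charge set T -> \bar R}) A : measurable A ->
  (pairing mu (\1_A : T -> R))%:E = mu A.
Proof.
move=> mA; rewrite /pairing /Rintegral !integral_indic// !setIT.
by rewrite EFinB !fineK ?fin_num_measure// -chargeE_parts.
Qed.

Variables (E : tvsType R) (J : E -> {charge set T -> \bar R}).
Hypotheses (realJ : realizes X J) (compJ : compatible Y J).

(** Compatibility speaks of bundled linear maps, so the pairing is first shown linear along [J] and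
    packaged as one. *)
Lemma pairing_continuous h : Y h -> continuous (fun u => pairing (J u) h : R^o).
Proof.
move=> Yh; pose f : E -> R^o := fun u => pairing (J u) h.
have int u : (Defs.total_variation (J u)).-integrable setT (EFin \o h).
  exact: (duality_integrable (decomposable_duality decXY) (realizes_in realJ u) Yh).
have lin : linear f.
  by move=> a u v; exact: (pairing_linear (realizes_linear realJ a u v)).
pose lf := GRing.isLinear.Build _ _ _ _ f lin.
pose l : {linear E -> R^o} := HB.pack f lf.
by apply/(compJ l); exists h.
Qed.

(** Failure is witnessed by a strict inequality on one pairing with an indicator: a negative value
    on some set, or a total mass below or above 1. Such an inequality persists nearby. *)
Lemma not_prob_charge_near u : ~ prob_charge (J u) ->
  \forall v \near u, ~ prob_charge (J v).
Proof.
have charge_cvg A : measurable A ->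
    (pairing (J v) (\1_A : T -> R) : R^o) @[v --> u] --> (pairing (J u) \1_A : R^o).
  by move=> mA; exact: (pairing_continuous (indic_in_function_space mA)).
move=> /not_andP[/existsNP[A /not_implyP[mA /negP]]|JT].
  rewrite -ltNge -pairing_indic// lte_fin => JA.
  apply: (filterS _ (cvgr_lt _ (charge_cvg A mA) _ JA)) => v /= vA [+ _].
  by move=> /(_ A mA); rewrite -pairing_indic// lee_fin leNgt vA.
have : (pairing (J u) \1_[set: T] != 1)%R.
  by apply/eqP => e; apply: JT; rewrite -pairing_indic// e.
have mT := @measurableT _ T.
rewrite neq_lt => /orP[J1|J1].
  apply: (filterS _ (cvgr_lt _ (charge_cvg _ mT) _ J1)) => v /= vA [_].
  by rewrite -pairing_indic// => -[e]; move: vA; rewrite e ltxx.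
apply: (filterS _ (cvgr_gt _ (charge_cvg _ mT) _ J1)) => v /= vA [_].
by rewrite -pairing_indic// => -[e]; move: vA; rewrite e ltxx.
Qed.

End compatible_topology.

(** * Lower semicontinuity and the variational formula *)

Lemma ereal_lt_between (R : realType) (x y : \bar R) : x < y ->
  exists a : R, x < a%:E /\ a%:E < y.
Proof.
case: x y => [x| |] [y| |] //.
- by rewrite lte_fin => xy; exists ((x + y) / 2)%R; rewrite !lte_fin; split; lra.
- by move=> _; exists (x + 1)%R; rewrite lte_fin ltry; split => //; lra.
- by move=> _; exists (y - 1)%R; rewrite lte_fin ltNyr; split => //; lra.
- by move=> _; exists 0%R; rewrite ltNyr ltry.
Qed.

Theorem corollary4p3p5 (R : realType) (d : measure_display)
    (T : measurableType d)
    (nontrivial : [set set0; [set: T]] `<` @measurable d T)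
    (phi : R -> \bar R)
    (phi_ninfty : forall x, phi x != -oo)
    (phi_convex : convex_ereal phi)
    (phi_lsc : lower_semicontinuous phi)
    (phi1 : phi 1%R = 0)
    (phi_dom : \forall x \near (1%R : R), phi x < +oo)
    (nu : probability T R)
    (X : set ({charge set T -> \bar R})) (Y : set (T -> R))
    (decXY : decomposable nu X Y) :
  [/\ (forall mu, X mu -> phi_div_prob phi nu mu != -oo),
      (forall (E : tvsType R) (J : E -> {charge set T -> \bar R}),
         realizes X J -> compatible Y J ->
         lower_semicontinuous (fun u : E => phi_div_prob phi nu (J u)))
    & forall mu, X mu -> prob_charge mu ->
        phi_div phi mu nu =
        ereal_sup [set (pairing mu g)%:E -
          ereal_inf [set \int[nu]_x convex_conjugate (phi_plus phi)
                                      (g x + l)%R - l%:E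
            | l in [set l : R |
                l%:E + ess_sup_mod (common_null_ideal X) g
                  <= slope_pinfty phi]]
          | g in Y] ].
Proof.
have divN mu : prob_charge mu -> -oo < phi_div phi mu nu.
  by case=> mu0 _; exact: phi_div_gtNy.
split.
- move=> mu Xmu; rewrite /phi_div_prob; case: asboolP => // pmu.
  by rewrite -ltNye divN.
- move=> E J realJ compJ u a; rewrite /phi_div_prob.
  case: asboolP => [pu /(phi_div_approx phi_ninfty phi_convex phi_lsc phi1 phi_dom
      decXY (realizes_in realJ u) pu)[g [k [Yg gslope psik ak]]]|npu _]; last first.
    exists [set v | ~ prob_charge (J v)]; first exact: (not_prob_charge_near decXY realJ compJ npu).
    by move=> v /= npv; case: asboolP => // _; rewrite ltry.
  (* The pair [g], [k] does not depend on the point: the inequality holds near [u] by continuity,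
     and [pairing_le] with [l = 0] turns it into a bound on the divergence at every nearby
     probability. *)
  have ak' : (a + k < pairing (J u) g)%R by lra.
  have cvg_g : (pairing (J v) g : R^o) @[v --> u] --> (pairing (J u) g : R^o).
    exact: (pairing_continuous decXY realJ compJ Yg).
  exists [set v | (a + k < pairing (J v) g)%R]; first exact: (cvgr_gt _ cvg_g _ ak').
  move=> v /= vak; case: asboolP => [pv|_]; last by rewrite ltry.
  have := @pairing_le _ _ _ _ _ phi_ninfty phi_convex phi_lsc phi1 phi_dom _ _
    decXY _ g 0%R (realizes_in realJ v) pv Yg.
  rewrite add0e => /(_ (ess_sup_mod_le X gslope)); rewrite addr0.
  under eq_integral do rewrite addr0.
  move=> le1; have := le_trans le1 (leeD2l _ psik).
  rewrite -leeBlDr// -EFinB; apply: lt_le_trans.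
  by rewrite lte_fin; lra.
- move=> mu Xmu pmu; apply/eqP; rewrite eq_le; apply/andP; split.
    (* A real [a] strictly between the supremum and the divergence would be exceeded by one test
       function, with shift 0 in the infimum. *)
    rewrite leNgt; apply/negP => /ereal_lt_between[a [supa]].
    move=> /(phi_div_approx phi_ninfty phi_convex phi_lsc phi1 phi_dom decXY Xmu pmu).
    move=> [g [k [Yg gslope psik ak]]]; move: supa; apply/negP; rewrite -leNgt.
    apply: (@le_trans _ _ ((pairing mu g)%:E - k%:E)).
      by rewrite -EFinB lee_fin ltW.
    apply: le_trans (ereal_sup_ubound (ex_intro2 _ _ g Yg erefl)).
    apply: leeB => //; apply: le_trans (ereal_inf_lbound _) psik.
    exists 0%R => /=; first by rewrite add0e; exact: ess_sup_mod_le.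
    by under eq_integral do rewrite addr0; rewrite sube0.
  apply: ge_ereal_sup => _ [g Yg <-].
  have dual l := @pairing_le _ _ _ _ _ phi_ninfty phi_convex phi_lsc phi1 phi_dom _ _
    decXY _ g l Xmu pmu Yg.
  (* With a finite divergence [D], the inequality can be solved for each member of the infimum. If
     no shift is admissible the infimum is [+oo] and the term is [-oo]. *)
  move: (divN _ pmu) dual; case: (phi_div phi mu nu) => [D| |] // _ dual; last by rewrite leey.
  have : (pairing mu g - D)%:E <= ereal_inf [set \int[nu]_x convex_conjugate
      (phi_plus phi) (g x + l)%R - l%:E | l in [set l : R |
        l%:E + ess_sup_mod (common_null_ideal X) g <= slope_pinfty phi]].
    apply: le_ereal_inf_tmp => _ [l /dual lg <-].
    rewrite leeBrDr// -EFinD; move: lg; rewrite -leeBlDl// -EFinB; apply: le_trans.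
    by rewrite lee_fin; lra.
  case: (ereal_inf _) => [i| |] //; last by rewrite addeNy leNye.
  by rewrite -EFinB !lee_fin; lra.
Qed.
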